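(* Let $m\ge1$, $n\ge0$ be integers, let $l,k$ be relatively prime positive integers with $l<k$, and let $q=e^{i\pi l/k}$. Equip the finite-dimensional Fock space $F_{l/k}(n|m)$ of $Cl_q(n|m)$ with the Hermitian form $(\cdot,\cdot)$ induced from the one on $F(n|m)$. Then $F_{l/k}(n|m)$ is a Hilbert space (i.e. $(\cdot,\cdot)$ is positive definite on it) only if $l=1$, and for $l=1$ it is a Hilbert space for every integer $k>1$; that is, exactly when $q$ is a primitive root of unity in the sense $q=e^{i\pi/k}$.
   Context: Notation: $\langle i\rangle=1$ for $i\le m$ and $\langle i\rangle=0$ for $i>m$; $[x]=\frac{q^x-q^{-x}}{q-q^{-1}}$; $[r]!=[r][r-1]\cdots[1]$; $q=e^h$ with $h=i\pi l/k$, $q^{\pm1/2}=e^{\pm h/2}$; $c_q=\frac{2}{q^{1/2}+q^{-1/2}}=1/\cos(\pi l/(2k))$. The deformed Clifford superalgebra $Cl_q(n|m)$ is the associative unital superalgebra with generators $c_i^\pm$, $N_i$ ($i=1,\ldots,m+n$), of degrees $\deg(c_i^\pm)=\langle i\rangle$, $\deg(N_i)=0$ in $\mathbb{Z}_2$, and relations - $[N_i,N_j]=0$, $[N_i,c_j^\pm]=\pm\delta_{ij}c_j^\pm$; - $c_i^-c_i^+ +(-1)^{\langle i\rangle}q^{\pm1}c_i^+c_i^-=c_q\,q^{\pm(-1)^{\langle i\rangle}N_i}$ (both signs), equivalently $c_i^+c_i^-=c_q[N_i]$ and $c_i^-c_i^+=c_q[1-(-1)^{\langle i\rangle}N_i]$;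 - $c_i^\xi c_j^\eta=-(-1)^{\langle j\rangle}q^{\xi\eta}c_j^\eta c_i^\xi$ for all $i<j$ and $\xi,\eta=\pm$ (identified with $\pm1$); - $(c_i^\pm)^2=0$ for $i=m+1,\ldots,m+n$. For complex $q=e^h$, a $Cl_q(n|m)$-module is a complex vector space with operators $c_i^\pm$ and diagonalizable $N_i$ satisfying these relations, with $q^{\pm N_i}=e^{\pm hN_i}$. The Fock space $F(n|m)$ is the $Cl_q(n|m)$-module generated by a vacuum vector $|0\rangle$ with $c_i^-|0\rangle=0$ and $N_i|0\rangle=0$ for all $i$, in which the vectors $|r_1,\ldots,r_{m+n}\rangle=(c_1^+)^{r_1}\cdots(c_{m+n}^+)^{r_{m+n}}|0\rangle$ ($r_i\in\mathbb{Z}_{\ge 0}$ for $i\le m$, $r_i\in\{0,1\}$ for $i>m$) form a basis. The Hermitian form on $F(n|m)$ is determined by $(|0\rangle,|0\rangle)=1$, $(c_i^\pm v,w)=(v,c_i^\mp w)$, $(N_iv,w)=(v,N_iw)$; distinct basis vectors are orthogonal and $(|r_1,\ldots,r_{m+n}\rangle,|r_1,\ldots,r_{m+n}\rangle)=c_q^{r_1+\cdots+r_{m+n}}[r_1]!\cdots[r_m]!$. $F_{l/k}(n|m)=F(n|m)/I_{l/k}(n|m)$, where $I_{l/k}(n|m)$ is the invariant subspace spanned by the $|r_1,\ldots,r_{m+n}\rangle$ with $r_j\ge k$ for at least one $j\le m$; the form vanishes on $I_{l/k}(n|m)\times F(n|m)$ and so induces a form on the quotient, for which the classes of the vectors with $0\le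 r_1,\ldots,r_m\le k-1$, $r_{m+1},\ldots,r_{m+n}\in\{0,1\}$ form an orthogonal basis. *)

(* Defs.v *)
From HB Require Import structures.
From mathcomp Require Import all_boot all_order all_algebra.
From mathcomp Require Import boolp reals sequences trigo complex.

Set Implicit Arguments.
Unset Strict Implicit.
Unset Printing Implicit Defensive.
Import Order.TTheory GRing.Theory Num.Theory.
Local Open Scope ring_scope.
Local Open Scope quotient_scope.
Local Open Scope complex_scope.

(** * Spans, bases, quotients of modules of arbitrary dimension *)

Section Span.
Variables (K : nzRingType) (V : lmodType K) (T : eqType).

Definition in_span (P : pred T) (e : T -> V) (v : V) : Prop :=
  exists s : seq (K * T),
    all (fun p => P p.2) s /\ v = \sum_(p <- s) p.1 *: e p.2.

Definition span (P : pred T) (e : T -> V) : {pred V} :=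
  fun v => `[< in_span P e v >].

Definition lin_indep (P : pred T) (e : T -> V) : Prop :=
  forall (s : seq T) (a : T -> K), uniq s -> all P s ->
    \sum_(t <- s) a t *: e t = 0 -> forall t, t \in s -> a t = 0.

(** [e] restricted to the index set [P] is a (Hamel) basis of [V]. *)
Definition is_basis (P : pred T) (e : T -> V) : Prop :=
  lin_indep P e /\ forall v, in_span P e v.

Lemma span_submod_closed P e : submod_closed (span P e).
Proof.
split=> [|a u v /asboolP[s [sP ->]] /asboolP[t [tP ->]]]; apply/asboolP.
  by exists [::]; rewrite big_nil.
exists ([seq (a * p.1, p.2) | p <- s] ++ t); split.
  by rewrite all_cat tP andbT all_map.
rewrite big_cat big_map /= scaler_sumr; congr (_ + _).
by apply: eq_bigr => p _; rewrite scalerA.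
Qed.

HB.instance Definition _ P e :=
  GRing.isSubmodClosed.Build K V (span P e) (span_submod_closed P e).

End Span.

Section QuotientModule.
Variables (K : nzRingType) (V : lmodType K) (I : submodClosed V).

Fact submod_oppr_closed : oppr_closed (I : {pred V}).
Proof. by move=> u uI; rewrite -scaleN1r rpredZ. Qed.

Definition submod_zmod : zmodClosed V :=
  HB.pack (GRing.SubmodClosed.sort I)
    (GRing.isOppClosed.Build V (GRing.SubmodClosed.sort I) submod_oppr_closed).

(** The quotient module V / I: the additive quotient of the library, equipped
    with the induced scaling. *)
Definition lquot := Quotient.quot submod_zmod.

HB.instance Definition _ := GRing.Zmodule.on lquot.
HB.instance Definition _ := EqQuotient.on lquot.

Definition lquot_scale (a : K) (x : lquot) : lquot := \pi_lquot (a *: repr x).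

Lemma lquot_piE (u v : V) : (\pi_lquot u = \pi_lquot v) <-> (u - v \in I).
Proof.
have -> : (u - v \in I) = (u == v %[mod lquot]).
  exact: (Quotient.idealrBE submod_zmod).
by split=> [->|/eqP].
Qed.

Lemma lquot_scale_pi a v : lquot_scale a (\pi_lquot v) = \pi_lquot (a *: v).
Proof.
by apply/lquot_piE; rewrite -scalerBr rpredZ //; apply/lquot_piE; rewrite reprK.
Qed.

Lemma lquot_piD (u v : V) : \pi_lquot (u + v) = \pi_lquot u + \pi_lquot v.
Proof. exact: (raddfD \pi_(Quotient.quot submod_zmod)). Qed.

Fact lquot_scalerA a b v :
  lquot_scale a (lquot_scale b v) = lquot_scale (a * b) v.
Proof. by elim/quotW: v => v; rewrite (lquot_scale_pi b) !lquot_scale_pi scalerA. Qed.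
Fact lquot_scale1r : left_id 1 lquot_scale.
Proof. by elim/quotW=> v; rewrite lquot_scale_pi scale1r. Qed.
Fact lquot_scalerDr : right_distributive lquot_scale +%R.
Proof.
move=> a; elim/quotW=> u; elim/quotW=> v; rewrite -lquot_piD !lquot_scale_pi.
by rewrite scalerDr lquot_piD.
Qed.
Fact lquot_scalerDl v : {morph lquot_scale^~ v : a b / a + b}.
Proof.
by move=> a b; elim/quotW: v => v; rewrite !lquot_scale_pi scalerDl lquot_piD.
Qed.

HB.instance Definition _ := GRing.Zmodule_isLmodule.Build K lquot
  lquot_scalerA lquot_scale1r lquot_scalerDr lquot_scalerDl.

End QuotientModule.

Section Complex.
Variable R : realType.
Local Notation C := R[i].

(** Complex exponential. *)
Definition cexp (z : C) : C :=
  let: x +i* y := z in (expR x)%:C * (cos y +i* sin y).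

(** h = i pi l / k, so that q = e^h. *)
Definition hpar (l k : nat) : C := (pi * l%:R / k%:R) *i.

Definition qpar (h : C) : C := cexp h.

(** c_q = 2 / (q^(1/2) + q^(-1/2)), with q^(1/2) = e^(h/2). *)
Definition cqpar (h : C) : C := 2 / (cexp (h / 2) + cexp (- (h / 2))).

(** The signs + and - are encoded as [true] and [false]. *)
Definition sg (xi : bool) : C := if xi then 1 else -1.

Section Operators.
Variable V : lmodType C.

(** Every vector is a finite sum of eigenvectors. *)
Definition diagonalizable (f : V -> V) : Prop :=
  forall v, exists s : seq V,
    (forall u, u \in s -> exists a : C, f u = a *: u) /\ v = \sum_(u <- s) u.

(** For diagonalizable [N] and linear [E], this says E = phi(N): on the
    eigenspace of [N] for the eigenvalue [a], [E] is the scalar [phi a]. *)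
Definition is_function_of (phi : C -> C) (N E : V -> V) : Prop :=
  forall (a : C) (v : V), N v = a *: v -> E v = phi a *: v.

End Operators.

(** Bosonic indices are the first [m] ones, with <i> = 1; on ['I_(m + n)],
    indices start at 0, so <i> is the boolean [i < m]. *)
Definition bos (m n : nat) (i : 'I_(m + n)) : bool := (i < m)%N.

(** Operators of a Cl_q(n|m)-module: [cr true i] is c_i^+, [cr false i] is
    c_i^- and [num i] is N_i. *)
Record cl_ops (m n : nat) (V : lmodType C) := ClOps {
  cr : bool -> 'I_(m + n) -> {linear V -> V};
  num : 'I_(m + n) -> {linear V -> V} }.

Section Clifford.
Variables (m n : nat) (h : C) (V : lmodType C) (A : cl_ops m n V).
Local Notation c := (cr A).
Local Notation N := (num A).

Record is_cl_module : Prop := {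
  cl_num_diag : forall i, diagonalizable (N i);
  cl_num_comm : forall i j v, N i (N j v) = N j (N i v);
  cl_num_cr : forall i j xi v,
    N i (c xi j v) - c xi j (N i v) = (sg xi *+ (i == j)) *: c xi j v;
  cl_cr_same : forall i xi,
    is_function_of
      (fun a => cqpar h * cexp (h * (sg xi * (-1) ^+ bos i * a)))
      (N i)
      (fun v => c false i (c true i v)
                + ((-1) ^+ bos i * cexp (h * sg xi)) *: c true i (c false i v));
  cl_cr_diff : forall (i j : 'I_(m + n)) xi eta v, (i < j)%N ->
    c xi i (c eta j v)
    = (- (-1) ^+ bos j * cexp (h * (sg xi * sg eta))) *: c eta j (c xi i v);
  cl_cr_sq : forall i xi v, ~~ bos i -> c xi i (c xi i v) = 0 }.

Definition occupation := {ffun 'I_(m + n) -> nat}.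

Definition admissible (r : occupation) : bool :=
  [forall i, ~~ bos i ==> (r i <= 1)%N].

(** (c_1^+)^(r_1) ... (c_(m+n)^+)^(r_(m+n)) |0>; the factor with index 1 is
    applied last. *)
Definition ket (vac : V) (r : occupation) : V :=
  foldr (fun i v => iter (r i) (c true i) v) vac (enum 'I_(m + n)).

Record is_fock (vac : V) : Prop := {
  fock_module : is_cl_module;
  fock_annih : forall i, c false i vac = 0;
  fock_num : forall i, N i vac = 0;
  fock_basis : is_basis admissible (ket vac) }.

Record is_fock_form (vac : V) (B : {hermitian V for false & Num.conj}) : Prop :=
{ form_vac : B vac vac = 1;
  form_cr : forall i xi v w, B (c xi i v) w = B v (c (~~ xi) i w);
  form_num : forall i v w, B (N i v) w = B v (N i w) }.

Definition high (k : nat) (r : occupation) : bool :=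
  admissible r && [exists i, bos i && (k <= r i)%N].

(** F_(l/k) = F / I_(l/k). *)
Definition fock_quot (k : nat) (vac : V) : lmodType C :=
  lquot (span (high k) (ket vac)).

End Clifford.

(** The form induced on V / I. It does not depend on the representatives as
    soon as [B] vanishes on I x V, see [induced_form_pi]. *)
Definition induced_form (V : lmodType C) (I : submodClosed V) (B : V -> V -> C)
    (x y : lquot I) : C :=
  B (repr x) (repr y).

Lemma induced_form_pi (V : lmodType C) (I : submodClosed V)
    (B : {hermitian V for false & Num.conj}) :
  (forall u v, u \in I -> B u v = 0) ->
  forall v w, induced_form B (\pi_(lquot I) v) (\pi_(lquot I) w) = B v w.
Proof.
move=> BI v w; have E u : repr (\pi_(lquot I) u) - u \in I.
  by apply/lquot_piE; rewrite reprK.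
rewrite /induced_form -[X in B X _](subrK v) -[X in B _ X](subrK w).
by rewrite linearDl /= (BI _ _ (E v)) add0r linearDr /= hermC (BI _ _ (E w)) rmorph0
  mulr0 add0r.
Qed.

Definition positive_definite (V : lmodType C) (B : V -> V -> C) : Prop :=
  forall v, v != 0 -> 0 < B v v.

End Complex.

Arguments cexp {R} z : simpl never.

(* Main.v *)
Require Import Defs.
From mathcomp Require Import all_boot all_order all_algebra.
From mathcomp Require Import reals complex.
From mathcomp Require Import boolp exp trigo.
From mathcomp Require Import lra zify.
Local Open Scope ring_scope.

(** On the eigenspace of N_i for the eigenvalue r, the relations give
    c_i^- c_i^+ = c_q [1 - (-1)^<i> r], a real scalar.  Since c_i^- is adjoint
    to c_i^+, the squared norm of a basis vector is a product of such scalars,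
    and basis vectors are orthogonal because they have different N-eigenvalues.
    With q = e^(i pi l/k), c_q > 0 and [r] = sin(pi l r/k) / sin(pi l/k).  So
    [k] = 0; for l = 1 all of [1], ..., [k-1] are positive; for l > 1 the least
    r with l r >= k satisfies r < k and pi <= pi l r/k < 2 pi, hence [r] <= 0. *)

Set Implicit Arguments.
Unset Strict Implicit.
Unset Printing Implicit Defensive.
Import Order.TTheory GRing.Theory Num.Theory.
Local Open Scope complex_scope.
Local Open Scope quotient_scope.

(** * Linear combinations and independence *)

Section Span.
Variables (K : nzRingType) (V : lmodType K) (T : eqType).
Variables (P : pred T) (e : T -> V).

(** Repeated indices are merged by adding their coefficients; independence and orthogonality are
    applied to duplicate-free lists. *)
Lemma in_span_uniq v : in_span P e v ->
  exists (s : seq T) (a : T -> K),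
    [/\ uniq s, all P s & v = \sum_(t <- s) a t *: e t].
Proof.
case=> s [sP ->].
exists (undup [seq p.2 | p <- s]), (fun t => \sum_(p <- s | p.2 == t) p.1).
split; first exact: undup_uniq.
  by apply/allP=> t; rewrite mem_undup => /mapP[p ps ->]; exact: (allP sP).
under [RHS]eq_bigr do rewrite scaler_suml big_mkcond.
rewrite exchange_big /= big_seq [RHS]big_seq; apply: eq_bigr => p ps.
rewrite (bigD1_seq p.2) ?undup_uniq ?mem_undup ?map_f //= eqxx.
by rewrite big1 ?addr0 // => t; rewrite eq_sym => /negbTE ->.
Qed.

Lemma mem_span t : P t -> e t \in Defs.span P e.
Proof.
move=> Pt; apply/asboolP; exists [:: (1, t)].
by rewrite /= Pt big_seq1 scale1r.
Qed.

End Span.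

(** Otherwise adjoining [t] with coefficient -1 would give a nontrivial relation. This is what keeps
    classes of basis vectors nonzero in the quotient. *)
Lemma span_basisN (K : nzRingType) (V : lmodType K) (T : eqType) (P Q : pred T)
    (e : T -> V) t :
  lin_indep P e -> subpred Q P -> P t -> ~~ Q t -> e t \notin Defs.span Q e.
Proof.
move=> li QP Pt Qt; apply/asboolP => /in_span_uniq[s [a [us sQ et]]].
have ts : t \notin s by apply: contra Qt; exact: (allP sQ).
pose b u := if u == t then -1 else a u.
have bE : \sum_(u <- t :: s) b u *: e u = 0.
  rewrite big_cons /b eqxx scaleN1r {1}et; apply/eqP; rewrite addrC subr_eq0.
  apply/eqP/eq_big_seq => u us'; case: eqP => // ut.
  by rewrite -ut us' in ts.
have := li (t :: s) b _ _ bE t; rewrite /= ts us Pt (sub_all QP sQ) mem_head.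
move=> /(_ isT isT isT) /eqP; rewrite /b eqxx oppr_eq0.
by rewrite oner_eq0.
Qed.

(** [a'] times the first equation minus [a] times the second cancels [Y]. It serves to isolate c_i^-
    c_i^+ from the two signs of its relation. *)
Lemma scale_eliminate (K : comNzRingType) (V : lmodType K) (X Y v : V) s a a' b b' :
  X + (s * a) *: Y = b *: v -> X + (s * a') *: Y = b' *: v ->
  (a' - a) *: X = (a' * b - a * b') *: v :> V.
Proof.
move=> E E'; rewrite [RHS]scalerBl -!scalerA -E -E' !scalerDr !scalerA opprD.
by rewrite addrACA -!scalerBl [a' * _]mulrC mulrAC [a * _]mulrC subrr scale0r addr0.
Qed.

(** * The exponential on the imaginary axis *)

Section CexpIm.
Variable R : realType.
Implicit Types x y : R.

Lemma cexp_im x : cexp (x *i) = cos x +i* sin x.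
Proof. by rewrite /cexp expR0 mul1r. Qed.

Lemma cexp_imD x y : cexp ((x + y) *i) = cexp (x *i) * cexp (y *i).
Proof. by rewrite !cexp_im sinD cosD; simpc; rewrite addrC [cos x * _ + _]addrC. Qed.

Lemma cexp_imBN x : cexp (x *i) - cexp ((- x) *i) = (sin x *+ 2) *i.
Proof. by rewrite !cexp_im sinN cosN; apply/eqP; rewrite eq_complex /= subrr opprK mulr2n !eqxx. Qed.

Lemma mulr_im_real x y : x *i * y%:C = (x * y) *i.
Proof. by simpc. Qed.

Lemma cqpar_im x : cqpar (x *i) = ((cos (x / 2))^-1)%:C.
Proof.
rewrite /cqpar; have -> : x *i / 2 = (x / 2) *i.
  rewrite (_ : 2^-1 = (2^-1)%:C) ?mulr_im_real //.
  by rewrite fmorphV /= rmorph_nat.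
rewrite (_ : - (x / 2) *i = (- (x / 2)) *i); last by simpc.
rewrite !cexp_im cosN sinN (_ : _ + _ = (2 * cos (x / 2))%:C); last first.
  by apply/eqP; rewrite eq_complex /= subrr mulr_natl mulr2n !eqxx.
rewrite rmorphM /= rmorph_nat invfM mulrA divff ?mul1r ?fmorphV //.
by rewrite pnatr_eq0.
Qed.

End CexpIm.

(** * Scalars of c_i^- c_i^+ and squared norms *)

Section Weights.
Variables (R : realType) (theta : R) (m n : nat).

(** The scalar [c_q [1 - (-1)^<i> r]] by which [c_i^- c_i^+] acts on the
    eigenspace of [N_i] for the eigenvalue [r]. *)
Definition weight (i : 'I_(m + n)) (r : nat) : R :=
  (cos (theta / 2))^-1 * (sin (theta * (1 - (-1) ^+ bos i * r%:R)) / sin theta).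

(** For admissible [r] and [sin theta != 0] this is c_q^(r_1 + ... + r_(m+n)) [r_1]! ... [r_m]!. *)
Definition qnorm (r : occupation m n) : R :=
  \prod_i \prod_(j < r i) weight i j.

End Weights.

(** * The Hermitian form on the Fock space, for a general angle *)

Section Fock.
Variables (R : realType) (theta : R) (m n : nat).
Hypothesis sin_theta : sin theta != 0.
Variables (V : lmodType R[i]) (A : cl_ops m n V).
Local Notation c := (cr A).
Local Notation N := (num A).
Local Notation h := (theta *i).

Lemma cm_cp_eigen i (r : nat) v : is_cl_module h A ->
  N i v = r%:R *: v -> c false i (c true i v) = (weight theta i r)%:C *: v.
Proof.
move=> mA Nv; set X := c false i _; set Y := c true i (c false i v).
pose x := theta * ((-1) ^+ bos i * r%:R).
have arg xi : h * (sg R xi * (-1) ^+ bos i * r%:R) = ((if xi then x else - x) *i).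
  rewrite (_ : sg R xi * _ * _ = ((if xi then 1 else -1) * ((-1) ^+ bos i * r%:R))%:C).
    by rewrite mulr_im_real; case: xi; rewrite ?mul1r ?mulN1r ?mulrN.
  by rewrite !rmorphM /= rmorph_sign rmorph_nat mulrA; case: xi; rewrite /sg ?rmorphN rmorph1.
have argq xi : h * sg R xi = ((if xi then theta else - theta) *i).
  by case: xi; rewrite /sg ?mulrN mulr1 //; simpc.
have E xi : X + ((-1) ^+ bos i * cexp ((if xi then theta else - theta) *i)) *: Y
            = (cqpar h * cexp ((if xi then x else - x) *i)) *: v.
  by rewrite -argq -arg; exact: (cl_cr_same mA).
have Ep := E true; have Em := E false; rewrite /= in Ep Em.
set d : R[i] := (sin theta *+ 2) *i.
have d0 : d != 0 by rewrite eq_complex /= eqxx /= mulrn_eq0 /= .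
(* Eliminating [Y] gives -2i sin(theta) on the left and -2i c_q sin(theta - x) on the right, hence
   the passage to opposites. *)
have dX : d *: X = (cqpar h * (sin (theta - x) *+ 2) *i) *: v.
  apply: oppr_inj; rewrite -!scaleNr /d.
  rewrite -mulrN -!cexp_imBN !opprB (scale_eliminate Ep Em); congr (_ *: v).
  rewrite mulrBr 2!(mulrCA (cexp _) (cqpar _)) -!cexp_imD.
  by rewrite [- theta + x]addrC.
apply: (scalerI d0); rewrite dX scalerA; congr (_ *: v).
rewrite /weight -/x cqpar_im mulrBr mulr1 -/x /d.
rewrite mulr_im_real [LHS]mulrC mulr_im_real.
congr (Complex 0 _); move: (cos _)^-1 (sin (theta - x)) => a b.
by rewrite [RHS]mulrCA [X in _ = _ * X]mulrnAl [sin theta * _]mulrCA divff ?mulr1 // mulrC.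
Qed.

Lemma num_iter_cp i j (a : nat) t v : is_cl_module h A -> N i v = a%:R *: v ->
  N i (iter t (c true j) v) = (a + (i == j) * t)%:R *: iter t (c true j) v.
Proof.
move=> mA Nv; elim: t => [|t IH] /=; first by rewrite muln0 addn0.
rewrite -[LHS](subrK (c true j (N i (iter t (c true j) v)))) (cl_num_cr mA) IH.
rewrite linearZ /= -scalerDl; congr (_ *: _).
rewrite /sg; case: (i == j) => /=; last by rewrite !mul0n mulr0n add0r.
by rewrite !mul1n addnS -natr1 mulr1n addrC.
Qed.

Variable vac : V.
Hypothesis fA : is_fock h A vac.
Variable B : {hermitian V for false & Num.conj}.
Hypothesis fB : is_fock_form A vac B.
Let mA := fock_module fA.
Local Notation ket := (ket A vac).

(** [ket] with the enumeration of all modes replaced by an arbitrary list, to allow induction on the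
    list. *)
Let ketl s (r : occupation m n) :=
  foldr (fun i v => iter (r i) (c true i) v) vac s.

Let num_ketl s r i : N i (ketl s r) = (r i * count_mem i s)%:R *: ketl s r.
Proof.
elim: s => [|j s IH] /=; first by rewrite (fock_num fA) muln0 scale0r.
rewrite (num_iter_cp _ _ mA IH) eq_sym; congr (_%:R *: _).
by rewrite mulnDr addnC; case: eqP => [->|_]; rewrite ?mul1n ?muln1 ?mul0n ?muln0.
Qed.

Lemma num_ket r i : N i (ket r) = (r i)%:R *: ket r.
Proof. by rewrite [LHS]num_ketl count_uniq_mem ?enum_uniq // mem_enum muln1. Qed.

(** Adjointness moves one c_i^+ across as c_i^-; then c_i^- c_i^+ acts by [weight theta i t], since
    N_i has eigenvalue [t] after [t] applications of c_i^+. *)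
Lemma form_iter_cp i t v : N i v = 0 ->
  B (iter t (c true i) v) (iter t (c true i) v)
  = (\prod_(j < t) weight theta i j)%:C * B v v.
Proof.
move=> Nv; elim: t => [|t IH]; first by rewrite big_ord0 mul1r.
rewrite [iter t.+1 _ _]/= (form_cr fB) /=.
rewrite (@cm_cp_eigen _ t) //; last first.
  rewrite (@num_iter_cp _ _ 0) ?eqxx ?mul1n ?add0n //.
  by rewrite Nv scale0r.
rewrite linearZr_LR /= IH big_ord_recr /= [X in _ = X%:C * _]mulrC.
rewrite (rmorphM _ (weight theta i t)) /= mulrA; congr (_ * _ * _).
(* The scalar left the antilinear second argument conjugated, but it is real. *)
exact: conjc_real.
Qed.

Let form_ketl s r : uniq s ->
  B (ketl s r) (ketl s r) = (\prod_(i <- s) \prod_(j < r i) weight theta i j)%:C.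
Proof.
elim: s => [|i s IH] /=; first by rewrite big_nil (form_vac fB).
case/andP=> i_s us; rewrite form_iter_cp ?big_cons ?rmorphM ?IH //.
(* Mode [i] is absent from the tail, so N_i annihilates the tail vector. *)
by rewrite num_ketl (count_memPn i_s) muln0 scale0r.
Qed.

Lemma form_ket r : B (ket r) (ket r) = (qnorm theta r)%:C.
Proof. by rewrite [LHS]form_ketl ?enum_uniq // /qnorm big_enum. Qed.

(** Self-adjointness of N_i gives (r_i - r'_i) B = 0 for a mode [i] where the occupations differ. *)
Lemma form_ket_orthogonal r r' : r != r' -> B (ket r) (ket r') = 0.
Proof.
move=> rr'; have [i ri] : exists i, r i != r' i.
  apply/existsP; apply: contraNT rr' => /existsPn E.
  by apply/eqP/ffunP=> i; apply/eqP; rewrite -[_ == _]negbK E.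
have := form_num fB i (ket r) (ket r').
rewrite !num_ket linearZl_LR linearZr_LR /= rmorph_nat => /eqP.
by rewrite -subr_eq0 -mulrBl mulf_eq0 subr_eq0 eqr_nat (negbTE ri) => /eqP.
Qed.

Lemma form_ket_sum s (a : occupation m n -> R[i]) : uniq s ->
  B (\sum_(r <- s) a r *: ket r) (\sum_(r <- s) a r *: ket r)
  = \sum_(r <- s) `|a r| ^+ 2 * (qnorm theta r)%:C.
Proof.
move=> us; rewrite linear_sumlz /= big_seq [RHS]big_seq; apply: eq_bigr => r rs.
rewrite linear_sumr /= (bigD1_seq r) //= big1 ?addr0 => [|r' r'r].
  by rewrite linearZl_LR linearZr_LR /= form_ket mulrA normCK.
by rewrite linearZl_LR linearZr_LR /= form_ket_orthogonal 1?eq_sym // !mulr0.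
Qed.

End Fock.

(** * The case q = e^(i pi l/k): null vectors, quotient and positivity *)

Section RootOfUnity.
Variables (R : realType) (m n l k : nat).
Hypotheses (l_gt0 : (0 < l)%N) (l_lt_k : (l < k)%N).
Implicit Types (i : 'I_(m + n)) (r : occupation m n).

Definition angle (l k : nat) : R := pi * l%:R / k%:R.
Local Notation theta := (angle l k).

Let k_gt0 : 0 < k%:R :> R. Proof. by rewrite ltr0n (leq_trans _ l_lt_k). Qed.

Lemma angle_gt0 : 0 < theta.
Proof. by rewrite divr_gt0 // mulr_gt0 ?pi_gt0 ?ltr0n. Qed.

Lemma angle_lt_pi : theta < pi.
Proof. by rewrite ltr_pdivrMr // ltr_pM2l ?pi_gt0 // ltr_nat. Qed.

Lemma sin_angle_gt0 : 0 < sin theta.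
Proof. by rewrite sin_gt0_pi // angle_gt0 angle_lt_pi. Qed.

Lemma cos_half_angle_gt0 : 0 < cos (theta / 2).
Proof.
apply: cos_gt0_pihalf; have := angle_gt0; have := angle_lt_pi.
by have := pi_gt0 R; lra.
Qed.

Lemma sin_mulr_pi (j : nat) : sin (pi * j%:R) = 0 :> R.
Proof.
elim: j => [|j IH]; first by rewrite mulr0 sin0.
by rewrite -natr1 mulrDr mulr1 sinDpi IH oppr0.
Qed.

Lemma weight_bos i j : bos i ->
  weight theta i j = (cos (theta / 2))^-1 * (sin (theta * j.+1%:R) / sin theta).
Proof. by move=> bi; rewrite /weight bi expr1 mulN1r opprK nat1r. Qed.

Lemma weight_ferm0 i : weight theta i 0 = (cos (theta / 2))^-1.
Proof. by rewrite /weight mulr0 subr0 mulr1 divff ?mulr1 // gt_eqF ?sin_angle_gt0. Qed.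

Lemma weight_bos_gt0 i j : bos i ->
  (0 < weight theta i j) = (0 < sin (theta * j.+1%:R)).
Proof.
move=> bi; rewrite weight_bos // pmulr_rgt0 ?invr_gt0 ?cos_half_angle_gt0 //.
by rewrite pmulr_lgt0 ?invr_gt0 ?sin_angle_gt0.
Qed.

Lemma qnorm_high r : high k r -> qnorm theta r = 0.
Proof.
case/andP=> _ /existsP[i /andP[bi ki]].
have k0 : (0 < k)%N := leq_trans l_gt0 (ltnW l_lt_k).
(* The weight at index [j] carries [j + 1], so the vanishing factor [k] sits at index [k.-1]. *)
have lt_ri : (k.-1 < r i)%N by rewrite prednK.
rewrite /qnorm (bigD1 i) //= (bigD1 (Ordinal lt_ri)) //= weight_bos //.
rewrite prednK // /angle mulfVK ?gt_eqF //.
by rewrite sin_mulr_pi mul0r mulr0 !mul0r.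
Qed.

Variables (V : lmodType R[i]) (A : cl_ops m n V) (vac : V).
Variable B : {hermitian V for false & Num.conj}.
Hypotheses (fA : is_fock (theta *i) A vac) (fB : is_fock_form A vac B).
Local Notation ket := (ket A vac).
Local Notation F := (fock_quot A k vac).

Let sin_theta : sin theta != 0. Proof. by rewrite gt_eqF ?sin_angle_gt0. Qed.

(** Against any basis vector, a high one gives zero: by orthogonality if they differ, by its zero
    norm if they agree. Hence the induced form is independent of representatives. *)
Lemma form_high u v : u \in Defs.span (high k) ket -> B u v = 0.
Proof.
move=> /asboolP[s [sh ->]].
rewrite linear_sumlz /= big_seq big1 // => p ps.
rewrite linearZl_LR /=; have [t [_ ->]] := (fock_basis fA).2 v.
rewrite linear_sumr /= big1 ?mulr0 // => p' _; rewrite linearZr_LR /=.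
have [<-|ne] := eqVneq p.2 p'.2.
  by rewrite (form_ket sin_theta fA fB) qnorm_high ?mulr0 //; exact: (allP sh).
by rewrite (form_ket_orthogonal fA fB) ?mulr0.
Qed.

Lemma induced_form_fock (v w : V) :
  induced_form B (\pi_F v) (\pi_F w) = B v w.
Proof. exact: (induced_form_pi form_high). Qed.

Lemma fock_quot_eq0 (v : V) : \pi_F v = 0 <-> v \in Defs.span (high k) ket.
Proof.
have pi0 : \pi_F 0 = 0.
  by apply: (addrI (\pi_F 0)); rewrite -[LHS]lquot_piD !addr0.
rewrite -pi0 -{2}(subr0 v); exact: lquot_piE.
Qed.

Lemma qnorm_gt0 r : l = 1%N -> admissible r -> ~~ high k r -> 0 < qnorm theta r.
Proof.
move=> l1 ar; rewrite /high ar /= => /existsPn low.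
apply: prodr_gt0 => i _; apply: prodr_gt0 => j _.
case: (boolP (bos i)) => bi.
  have := low i; rewrite bi /= -ltnNge => rk.
  have jk : (j.+1 < k)%N := leq_ltn_trans (ltn_ord j) rk.
  rewrite weight_bos_gt0 //; apply: sin_gt0_pi.
  rewrite /angle l1 mulr1 mulrAC divr_gt0 ?mulr_gt0 ?pi_gt0 ?ltr0n ?(ltn_trans _ jk) //=.
  by rewrite ltr_pdivrMr // ltr_pM2l ?pi_gt0 // ltr_nat.
(* A fermionic mode is occupied at most once and contributes only c_q. *)
have -> : j = 0%N :> nat.
  have := forallP ar i; rewrite bi /= => r1.
  by have := leq_trans (ltn_ord j) r1; case: (nat_of_ord j).
by rewrite weight_ferm0 invr_gt0 cos_half_angle_gt0.
Qed.

Local Notation hilbert := (positive_definite (induced_form B : F -> F -> R[i])).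

Lemma hilbert_l1 : l = 1%N -> hilbert.
Proof.
move=> l1 x; elim/quotW: x => v v0; rewrite induced_form_fock.
have [s [a [us sP vE]]] := in_span_uniq ((fock_basis fA).2 v).
have term_ge0 r : r \in s -> 0 <= `|a r| ^+ 2 * (qnorm theta r)%:C.
  move=> rs; rewrite mulr_ge0 ?exprn_ge0 // lecR.
  have [/qnorm_high -> //|low] := boolP (high k r).
  by rewrite ltW // qnorm_gt0 //; exact: (allP sP).
rewrite vE (form_ket_sum sin_theta fA fB) // big_seq lt_neqAle eq_sym.
(* If the sum of nonnegative terms vanished, each term would; the coefficients outside [high k]
   would then be 0, putting [v] in the subspace. *)
rewrite sumr_ge0 // andbT psumr_eq0 //; apply: contra v0 => /allP a0.
apply/eqP/fock_quot_eq0; rewrite vE big_seq; apply: rpred_sum => r rs.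
have [hr|low] := boolP (high k r); first by rewrite rpredZ ?mem_span.
have := a0 r rs; rewrite rs mulf_eq0 sqrf_eq0 normr_eq0 => /orP[/eqP ->|].
  by rewrite scale0r rpred0.
by rewrite -[0]/(0%:C) (inj_eq (@complexI _)) gt_eqF // qnorm_gt0 //; exact: (allP sP).
Qed.

Lemma exists_sin_le0 : (1 < l)%N ->
  exists2 j, (j.+1 < k)%N & sin (theta * j.+1%:R) <= 0.
Proof.
(* With this witness, j + 1 is the ceiling of k/l, the least r with l r >= k. *)
move=> l1; exists (k.-1 %/ l)%N; first by nia.
set j := (k.-1 %/ l)%N.
have klj : (k <= l * j.+1)%N by rewrite /j; nia.
have lj2k : (l * j.+1 <= 2 * k)%N by rewrite /j; nia.
have -> : theta * j.+1%:R = pi * (l * j.+1)%:R / k%:R.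
  by rewrite /angle natrM mulrA mulrAC.
(* The angle lies between pi and 2 pi; subtracting pi brings it to where the sine is nonnegative and
   flips the sign. *)
rewrite -[_ / _](subrK pi) sinDpi oppr_le0 sin_ge0_pi // subr_ge0 lerBlDr.
rewrite ler_pdivlMr // ler_pdivrMr // -mulr2n -[pi *+ 2]mulr_natr -!mulrA -natrM.
by rewrite !ler_pM2l ?pi_gt0 // !ler_nat klj.
Qed.

Lemma hilbert_qnorm_gt0 r : hilbert -> admissible r -> ~~ high k r ->
  0 < qnorm theta r.
Proof.
move=> hil ar low; rewrite -ltcR -(form_ket sin_theta fA fB) -induced_form_fock.
apply: hil; apply/eqP => /fock_quot_eq0; apply/negP.
apply: (span_basisN (fock_basis fA).1) => // r'.
by case/andP.
Qed.

Lemma hilbert_l_le1 : (0 < m)%N -> hilbert -> (l <= 1)%N.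
Proof.
move=> m_gt0 hil; rewrite leqNgt; apply/negP => /exists_sin_le0[j jk].
apply/negP; rewrite -ltNge.
pose i0 : 'I_(m + n) := Ordinal (ltn_addr n m_gt0).
have b0 : bos i0 by [].
(* Test vectors with only the first bosonic mode occupied. *)
pose occ t : occupation m n := [ffun i => if i == i0 then t else 0%N].
have occ_gt0 t : (t < k)%N -> 0 < qnorm theta (occ t).
  move=> tk; have adm : admissible (occ t).
    by apply/forallP => i; rewrite ffunE; case: eqP => [->|]; rewrite ?b0 ?implybT.
  apply: hilbert_qnorm_gt0 => //; rewrite /high adm /=; apply/existsPn => i.
  by rewrite ffunE negb_and -ltnNge; case: eqP => _; rewrite ?tk ?(leq_ltn_trans _ tk) ?orbT.
have qE t : qnorm theta (occ t) = \prod_(j < t) weight theta i0 j.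
  rewrite /qnorm (bigD1 i0) //= ffunE eqxx [X in _ * X]big1 ?mulr1 // => i ne.
  by rewrite ffunE (negbTE ne) big_ord0.
(* The norms for [j] and [j.+1] are both positive and their ratio is the weight at [j], so the sine
   assumed nonpositive is positive. *)
rewrite -(weight_bos_gt0 _ b0); have := occ_gt0 j.+1 jk.
by rewrite qE big_ord_recr /= -qE pmulr_rgt0 ?occ_gt0 // ltnW.
Qed.

End RootOfUnity.

Theorem proposition5 (R : realType) (m n l k : nat)
    (m_ge1 : (1 <= m)%N) (l_gt0 : (0 < l)%N) (l_lt_k : (l < k)%N)
    (l_k_coprime : coprime l k)
    (V : lmodType R[i]) (A : cl_ops m n V) (vac : V)
    (B : {hermitian V for false & Num.conj}) :
  is_fock (hpar R l k) A vac ->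
  is_fock_form A vac B ->
  let hilbert :=
    positive_definite (induced_form B : fock_quot A k vac -> fock_quot A k vac -> R[i]) in
  [/\ hilbert -> l = 1%N,
      l = 1%N -> hilbert &
      hilbert <-> qpar (hpar R l k) = qpar (hpar R 1 k)].
Proof.
move=> fA fB hilbert.
have hil1 : hilbert -> l = 1%N.
  move=> hil; apply/eqP; rewrite eqn_leq l_gt0 andbT.
  exact: (hilbert_l_le1 l_gt0 l_lt_k fA fB).
have l1hil : l = 1%N -> hilbert := hilbert_l1 l_gt0 l_lt_k fA fB.
split=> //; split=> [/hil1 -> //|].
(* Real parts suffice: both angles lie in [0, pi], where the cosine is injective. *)
rewrite /qpar /hpar !cexp_im => -[cos_eq _]; apply: l1hil.
have k_gt1 : (1 < k)%N := leq_ltn_trans l_gt0 l_lt_k.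
have dom j : (0 < j)%N -> (j < k)%N -> angle R j k \in `[0, pi].
  by move=> j0 jk; rewrite in_itv /= !ltW ?angle_gt0 ?angle_lt_pi.
have /(congr1 (fun x => x / pi * k%:R)) :=
  cos_inj (dom l l_gt0 l_lt_k) (dom 1%N isT k_gt1) cos_eq.
have pi0 : pi != 0 :> R by rewrite gt_eqF ?pi_gt0.
have k0 : k%:R != 0 :> R by rewrite pnatr_eq0 -lt0n ltnW.
rewrite /angle ![_ / k%:R / pi]mulrAC !mulfVK // ![pi * _]mulrC !mulfK //.
by move/eqP; rewrite eqr_nat => /eqP.
Qed.
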